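(* Let $H$ be a real Hilbert space, let $\alpha>0$ and $c>0$, and let $L:D(L)\subset H\to H$ be a linear m-accretive operator on $H$. On the domain $D(L)\times H$ define $$\mathcal{B}[U,V]^T=[\,LU+\alpha cU-\alpha V,\; -\alpha cU+\alpha V\,]^T,\qquad \tilde{\mathcal{B}}[U,V]^T=[\,LU+\alpha cU-\alpha\sqrt{c}\,V,\; -\alpha\sqrt{c}\,U+\alpha V\,]^T .$$ Then $\mathcal{B}$ is m-accretive on the weighted space $W_c$. Equivalently, $\tilde{\mathcal{B}}$ is m-accretive on $H\times H$.
   Context: A linear operator $L:D(L)\to H$ on a Hilbert space $H$ is accretive if $\langle LU,U\rangle\ge 0$ for every $U\in D(L)$; it is m-accretive if in addition $I+L$ maps $D(L)$ onto $H$. The space $H\times H$ carries its natural product inner product $\langle [U,V]^T,[\phi,\psi]^T\rangle_{H\times H}=\langle U,\phi\rangle_H+\langle V,\psi\rangle_H$. The space $W_c$ is $H\times H$ endowed with the weighted inner product $\langle [U,V]^T,[\phi,\psi]^T\rangle_c=c\langle U,\phi\rangle_H+\langle V,\psi\rangle_H$ (which is again a Hilbert space). *)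

(* Defs.v *)
From HB Require Import structures.
From mathcomp Require Import all_boot all_order all_algebra.
From mathcomp Require Import sesquilinear.
From mathcomp Require Import all_classical all_reals.
From mathcomp Require Import topology normedtype.
From mathcomp Require Import ring lra.

Set Implicit Arguments.
Unset Strict Implicit.
Unset Printing Implicit Defensive.

Import Order.TTheory GRing.Theory Num.Theory.
Import numFieldNormedType.Exports.

Local Open Scope classical_set_scope.
Local Open Scope ring_scope.

HB.mixin Record NormedModule_hasInner (R : realType) V of NormedModule R V := {
  inner : {dot V for @idfun R} ;
  inner_norm : forall x : V, `|x| ^+ 2 = inner x x
}.

#[short(type="hilbertType")]
HB.structure Definition Hilbert (R : realType) :=
  {V of CompleteNormedModule R V & NormedModule_hasInner R V}.

Section dot_theory.
Context {R : realType} {V : lmodType R} (f : {dot V for @idfun R}).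

Lemma dotC x y : f x y = f y x.
Proof. by rewrite hermC expr0 mul1r. Qed.

Lemma dotDl x y z : f (x + y) z = f x z + f y z.
Proof. exact: linearDl. Qed.

Lemma dotZl a x z : f (a *: x) z = a * f x z.
Proof. exact: linearZl_LR. Qed.

Lemma dotDr x y z : f z (x + y) = f z x + f z y.
Proof. by rewrite dotC dotDl !(dotC _ z). Qed.

Lemma dotZr a x z : f z (a *: x) = a * f z x.
Proof. by rewrite dotC dotZl (dotC _ z). Qed.

Lemma dot_gt0 x : x != 0 -> 0 < f x x.
Proof. exact: neq0_dnorm_gt0. Qed.

Lemma dot0 : f 0 0 = 0.
Proof. by rewrite -(scale0r (0 : V)) dotZl mul0r. Qed.

Lemma dot_ge0 x : 0 <= f x x.
Proof. by have [->|/dot_gt0/ltW//] := eqVneq x 0; rewrite dot0. Qed.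

Lemma dot_eq0 x : f x x = 0 -> x = 0.
Proof.
move=> fx0; apply/eqP/negPn/negP => /dot_gt0.
by rewrite fx0 ltxx.
Qed.

Lemma dot_sqr_le x y : f x y ^+ 2 <= f x x * f y y.
Proof.
have := dot_ge0 (f y y *: x + (- f x y) *: y).
rewrite dotDl !dotDr !dotZl !dotZr (dotC y x).
have [->|/dot_gt0 y0 h] := eqVneq y 0.
  by move=> _; rewrite -(scale0r (0 : V)) !dotZr !mul0r mulr0 expr0n lexx.
rewrite -(ler_pM2l y0) -subr_ge0; apply: le_trans h _.
by rewrite le_eqVlt; apply/orP; left; apply/eqP; ring.
Qed.

Definition dot_norm x := Num.sqrt (f x x).

Lemma dot_normD x y : dot_norm (x + y) <= dot_norm x + dot_norm y.
Proof.
rewrite -(@ler_pXn2r _ 2%N)// ?nnegrE ?addr_ge0 ?sqrtr_ge0//.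
rewrite sqrrD !sqr_sqrtr ?dot_ge0// dotDl !dotDr (dotC y x).
rewrite -sqrtrM ?dot_ge0//.
have : f x y <= Num.sqrt (f x x * f y y).
  apply: le_trans (ler_norm _) _.
  by rewrite -sqrtr_sqr ler_wsqrtr// dot_sqr_le.
by lra.
Qed.

Lemma dot_normZ a x : dot_norm (a *: x) = `|a| * dot_norm x.
Proof.
by rewrite /dot_norm dotZl dotZr mulrA -expr2 sqrtrM ?sqr_ge0// sqrtr_sqr.
Qed.

Lemma dot_norm0_eq0 x : dot_norm x = 0 -> x = 0.
Proof.
move/eqP; rewrite sqrtr_eq0 => h; apply: dot_eq0; apply/eqP.
by rewrite eq_le h dot_ge0.
Qed.

Definition dot_complete := forall F : set_system V, ProperFilter F ->
  (forall e : R, 0 < e -> exists x, F [set y | f (x - y) (x - y) < e]) ->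
  exists l, forall e : R, 0 < e -> F [set y | f (l - y) (l - y) < e].

End dot_theory.

HB.factory Record Lmodule_isHilbert (R : realType) V of GRing.Lmodule R V := {
  dot : {dot V for @idfun R} ;
  complete : dot_complete dot
}.

HB.builders Context R V of Lmodule_isHilbert R V.

HB.instance Definition _ := Lmodule_isNormed.Build R V
  (dot_normD dot) (dot_normZ dot) (@dot_norm0_eq0 _ _ dot).

Let normE (x : V) : `|x| = dot_norm dot x. Proof. by []. Qed.

Let sqr_normE (x : V) : `|x| ^+ 2 = dot x x.
Proof. by rewrite normE sqr_sqrtr// dot_ge0. Qed.

Let cauchy_cvg (F : set_system V) : ProperFilter F -> cauchy F -> cvg F.
Proof.
move=> FF /cauchyP Fc.
have [e e0|l Fl] := @complete F FF.
  have [|x Fx] := Fc (Num.sqrt e); first by rewrite sqrtr_gt0.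
  exists x; apply: filterS Fx => y; rewrite -ball_normE/= normE.
  by rewrite ltr_sqrt.
apply/cvg_ex; exists l; apply/cvgrPdist_lt => e e0.
apply: filterS (Fl _ (exprn_gt0 2 e0)) => y/=.
by rewrite -sqr_normE ltr_pXn2r// nnegrE// ltW.
Qed.

HB.instance Definition _ := Uniform_isComplete.Build V cauchy_cvg.

HB.instance Definition _ := NormedModule_hasInner.Build R V sqr_normE.

HB.end.

Section product_complete.
Context {R : realType} {H : hilbertType R}.

Lemma product_dot_complete (a b : R) (f : {dot (H * H)%type for @idfun R}) :
  0 < a -> 0 < b ->
  (forall x, f x x = a * inner x.1 x.1 + b * inner x.2 x.2) -> dot_complete f.
Proof.
move=> a0 b0 fE F FF Fc.
have cvg_proj (p : H * H -> H) (k : R) : 0 < k ->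
    (forall x y, k * `|p x - p y| ^+ 2 <= f (x - y) (x - y)) ->
    cvg (p @ F).
  move=> k0 kp; apply: cauchy_cvg; apply/cauchyP => e e0.
  have [|x Fx] := Fc (k * e ^+ 2); first by rewrite mulr_gt0// exprn_gt0.
  exists (p x); suff: F (p @^-1` ball (p x) e) by [].
  apply: filterS Fx => y /= xy; rewrite -ball_normE/=.
  rewrite -(@ltr_pXn2r _ 2%N)// ?nnegrE ?(ltW e0)// -(ltr_pM2l k0).
  exact: le_lt_trans (kp _ _) xy.
have /cvg_ex[l1 Fl1] : cvg (fst @ F).
  apply: (cvg_proj fst a a0) => x y.
  by rewrite fE inner_norm lerDl mulr_ge0 ?(ltW b0)// dot_ge0.
have /cvg_ex[l2 Fl2] : cvg (snd @ F).
  apply: (cvg_proj snd b b0) => x y.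
  by rewrite fE inner_norm lerDr mulr_ge0 ?(ltW a0)// dot_ge0.
exists (l1, l2) => e e0.
pose d k := Num.sqrt (e / 2 / k).
have d0 k : 0 < k -> 0 < d k by move=> k0; rewrite sqrtr_gt0 !divr_gt0.
have dE k : 0 < k -> k * d k ^+ 2 = e / 2.
  by move=> k0; rewrite sqr_sqrtr ?ltW ?divr_gt0// mulrC divfK// gt_eqF.
have /cvgrPdist_lt/(_ _ (d0 a a0)) F1 := Fl1.
have /cvgrPdist_lt/(_ _ (d0 b b0)) F2 := Fl2.
apply: filterS (filterI F1 F2) => y /= [y1 y2].
rewrite fE -!inner_norm (splitr e) ltrD//.
  by rewrite -(dE a)// ltr_pM2l// ltr_pXn2r// nnegrE// ltW// d0.
by rewrite -(dE b)// ltr_pM2l// ltr_pXn2r// nnegrE// ltW// d0.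
Qed.

End product_complete.

(** The product [H * H] of normed modules carries the maximum norm, which does
    not come from an inner product; the two product Hilbert spaces are therefore
    put on aliases of the type [H * H], with the same vector space structure. *)

Section natural_product.
Context {R : realType} (H : hilbertType R).

Definition hprod : Type := (H * H)%type.

HB.instance Definition _ := GRing.Lmodule.copy hprod (H * H)%type.

Definition hprod_inner (x y : hprod) : R := inner x.1 y.1 + inner x.2 y.2.

Fact hprod_inner_bilinear : bilinear_for
  (GRing.Scale.Law.clone _ _ *%R _)
  (GRing.Scale.Law.clone _ _ (@idfun R \; *%R) _) hprod_inner.
Proof.
by split=> z a x y; rewrite /hprod_inner/= ?(dotDl, dotDr, dotZl, dotZr); ring.
Qed.

HB.instance Definition _ :=
  bilinear_isBilinear.Build R hprod hprod R _ _ hprod_inner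
    hprod_inner_bilinear.

Fact hprod_inner_sym (x y : hprod) :
  hprod_inner x y = (-1) ^+ false * idfun (hprod_inner y x).
Proof.
by rewrite /hprod_inner expr0 mul1r (dotC _ x.1) (dotC _ x.2).
Qed.

HB.instance Definition _ :=
  isHermitianSesquilinear.Build R hprod false idfun hprod_inner hprod_inner_sym.

Fact hprod_inner_gt0 (x : hprod) : x != 0 -> 0 < hprod_inner x x.
Proof.
case: x => u v; rewrite xpair_eqE negb_and => /orP[u0|v0].
  by rewrite ltr_pwDl ?dot_gt0 ?dot_ge0.
by rewrite ltr_wpDl ?dot_gt0 ?dot_ge0.
Qed.

HB.instance Definition _ :=
  isDotProduct.Build R hprod hprod_inner hprod_inner_gt0.

Fact hprod_complete :
  dot_complete (hprod_inner : {dot hprod for @idfun R}).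
Proof.
by apply: (@product_dot_complete R H 1 1 hprod_inner) => // x; rewrite !mul1r.
Qed.

HB.instance Definition _ := Lmodule_isHilbert.Build R hprod hprod_complete.

End natural_product.

Section weighted_product.
Context {R : realType} (H : hilbertType R) (c : R) (c0 : 0 < c).

(** The hypothesis [c0] is an argument of the alias, since the weighted form is
    definite only for a positive weight. *)
Definition weighted of 0 < c : Type := (H * H)%type.

Let W := weighted c0.

HB.instance Definition _ := GRing.Lmodule.copy W (H * H)%type.

Definition weighted_inner (x y : W) : R := c * inner x.1 y.1 + inner x.2 y.2.

Fact weighted_inner_bilinear : bilinear_for
  (GRing.Scale.Law.clone _ _ *%R _)
  (GRing.Scale.Law.clone _ _ (@idfun R \; *%R) _) weighted_inner.
Proof.
by split=> z a x y; rewrite /weighted_inner/= ?(dotDl, dotDr, dotZl, dotZr);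
  ring.
Qed.

HB.instance Definition _ :=
  bilinear_isBilinear.Build R W W R _ _ weighted_inner weighted_inner_bilinear.

Fact weighted_inner_sym (x y : W) :
  weighted_inner x y = (-1) ^+ false * idfun (weighted_inner y x).
Proof.
by rewrite /weighted_inner expr0 mul1r (dotC _ x.1) (dotC _ x.2).
Qed.

HB.instance Definition _ :=
  isHermitianSesquilinear.Build R W false idfun weighted_inner
    weighted_inner_sym.

Fact weighted_inner_gt0 (x : W) : x != 0 -> 0 < weighted_inner x x.
Proof.
case: x => u v; rewrite xpair_eqE negb_and => /orP[u0|v0].
  by rewrite ltr_pwDl ?mulr_gt0 ?dot_gt0 ?dot_ge0.
by rewrite ltr_wpDl ?mulr_ge0 ?(ltW c0) ?dot_gt0 ?dot_ge0.
Qed.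

HB.instance Definition _ :=
  isDotProduct.Build R W weighted_inner weighted_inner_gt0.

Fact weighted_complete :
  dot_complete (weighted_inner : {dot W for @idfun R}).
Proof.
by apply: (@product_dot_complete R H c 1 weighted_inner) => // x; rewrite mul1r.
Qed.

HB.instance Definition _ := Lmodule_isHilbert.Build R W weighted_complete.

End weighted_product.

Lemma hprod_innerE (R : realType) (H : hilbertType R) (x y : hprod H) :
  inner x y = inner x.1 y.1 + inner x.2 y.2.
Proof. by []. Qed.

Lemma weighted_innerE (R : realType) (H : hilbertType R) (c : R) (c0 : 0 < c)
  (x y : weighted H c0) : inner x y = c * inner x.1 y.1 + inner x.2 y.2.
Proof. by []. Qed.

(** An operator [L : D(L) -> V] is a domain [D : set V] with a function
    [L : V -> V]; the values of [L] outside [D] are irrelevant. *)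

Section accretive.
Context {R : realType} (V : hilbertType R) (D : set V) (L : V -> V).

Definition linear_operator :=
  [/\ D 0, (forall (a : R) u v, D u -> D v -> D (a *: u + v)) &
      (forall (a : R) u v, D u -> D v -> L (a *: u + v) = a *: L u + L v)].

Definition accretive :=
  linear_operator /\ forall u, D u -> 0 <= inner (L u) u.

Definition m_accretive :=
  accretive /\ set_surj D [set: V] (fun u => u + L u).

End accretive.

Arguments linear_operator {R} V D L.
Arguments accretive {R} V D L.
Arguments m_accretive {R} V D L.

Section block_operators.
Context {R : realType} {H : hilbertType R}.
Variables (alpha c : R) (L : H -> H).

Definition opB (x : H * H) : H * H :=
  (L x.1 + (alpha * c) *: x.1 - alpha *: x.2,
   - ((alpha * c) *: x.1) + alpha *: x.2).

Definition opB_tilde (x : H * H) : H * H :=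
  (L x.1 + (alpha * c) *: x.1 - (alpha * Num.sqrt c) *: x.2,
   - ((alpha * Num.sqrt c) *: x.1) + alpha *: x.2).

End block_operators.

(* Main.v *)
Require Import Defs.
From mathcomp Require Import all_boot all_order all_algebra.
From mathcomp Require Import all_classical all_reals.
From mathcomp Require Import interval_inference topology normedtype sequences.
From mathcomp Require Import ring lra.

Import Order.TTheory GRing.Theory Num.Theory.
Local Open Scope classical_set_scope.
Local Open Scope ring_scope.

(** Accretivity of the block operator is completing a square: with the weight
    [c] on the first component the coupling terms combine into
    [<B(u, v), (u, v)>_c = c <L u, u> + alpha |c u - v|^2], which is nonnegative
    ([weighted_inner_opB]).

    For the range condition, [(I + B)(u, v) = (f, g)] is solved by elimination.
    The second row gives [v = (g + alpha c u) / (1 + alpha)], and the first row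
    becomes [k u + L u = f + alpha / (1 + alpha) g] with
    [k = 1 + alpha c / (1 + alpha)].  The constant [k] is not [1], so one needs
    that [k I + L] is onto for every [k > 0] as soon as it is for [k = 1]
    ([m_accretive_surj]).  This is a continuation argument: accretivity makes
    [(k I + L)^-1] Lipschitz with constant [1 / k], so Banach's fixed point
    theorem carries surjectivity from [k] to every [m] with [|m - k| < k]
    ([accretive_surj_near]), and finitely many such moves reach any [k > 0].

    The equivalence holds because [(u, v) |-> (sqrt c u, v)] is a surjective
    isometry from the weighted space to [H * H] that conjugates [opB] into
    [opB_tilde], and m-accretivity is invariant under such a conjugation
    ([m_accretive_isometry]). *)

Section accretive_theory.
Context {R : realType} {V : hilbertType R}.
Implicit Types (D : set V) (L : V -> V).

Lemma inner_le_norm (x y : V) : inner x y <= `|x| * `|y|.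
Proof.
apply: le_trans (ler_norm _) _.
rewrite -(@ler_pXn2r _ 2%N) ?nnegrE ?mulr_ge0 //.
by rewrite exprMn !inner_norm real_normK ?num_real // dot_sqr_le.
Qed.

Lemma dotNl (x z : V) : inner (- x) z = - inner x z.
Proof. by rewrite -scaleN1r dotZl mulN1r. Qed.

Lemma dotNr (x z : V) : inner z (- x) = - inner z x.
Proof. by rewrite dotC dotNl dotC. Qed.

(** Testing against an arbitrary vector turns a vector identity into a scalar
    one, which [ring] and [field] can decide. *)
Lemma inner_ext (x y : V) : (forall z, inner x z = inner y z) -> x = y.
Proof.
move=> xy; apply/subr0_eq/(@dot_eq0 _ _ inner).
by rewrite dotDl dotNl xy subrr.
Qed.

Lemma linear_operatorZ D L a u : linear_operator V D L -> D u ->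
  D (a *: u) /\ L (a *: u) = a *: L u.
Proof.
move=> [D0 DL LL] Du; have L0 : L 0 = 0.
  by have := LL (-1) _ _ D0 D0; rewrite scaler0 addr0 scaleN1r addNr.
rewrite -[a *: u]addr0; split; first exact: DL.
by rewrite LL // L0 addr0.
Qed.

Lemma linear_operatorB D L u v : linear_operator V D L -> D u -> D v ->
  D (u - v) /\ L (u - v) = L u - L v.
Proof.
move=> [_ DL LL] Du Dv; rewrite addrC -scaleN1r; split; first exact: DL.
by rewrite LL // scaleN1r addrC.
Qed.

(** Pair [k w + L w] with [w], drop the nonnegative term [<L w, w>] and apply
    Cauchy-Schwarz.  This is the bound [1 / k] on the inverse of [k I + L]. *)
Lemma accretive_norm_lower_bound D L (k : R) w : accretive V D L -> D w ->
  k * `|w| <= `|k *: w + L w|.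
Proof.
move=> [_ L_ge0] Dw; have [->|w0] := eqVneq w 0; first by rewrite normr0 mulr0.
rewrite -(@ler_pM2r _ `|w|) ?normr_gt0 //.
apply: le_trans (inner_le_norm _ _).
by rewrite dotDl dotZl -mulrA -expr2 inner_norm lerDl L_ge0.
Qed.

(** The equation [m u + L u = y] reads [u = (k I + L)^-1 (y + (k - m) u)], whose
    right-hand side is a contraction of [u] with ratio [|k - m| / k]. *)
Lemma accretive_surj_near D L (k m : R) : accretive V D L ->
  `|k - m| < k ->
  set_surj D [set: V] (fun u => k *: u + L u) ->
  set_surj D [set: V] (fun u => m *: u + L u).
Proof.
move=> accL km surjk y _; have k0 : 0 < k by exact: le_lt_trans km.
have /choice[J JP] : forall z, exists u, D u /\ k *: u + L u = z.
  by move=> z; have [u Du uz] := surjk z I; exists u.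
pose f x := J (y + (k - m) *: x).
have fT : set_fun [set: V] [set: V] f by [].
have q0 : 0 <= `|k - m| / k by rewrite divr_ge0 // ltW.
have ctrf : is_contraction (mkfun fT).
  exists (NngNum q0); split => /=; first by rewrite ltr_pdivrMr // mul1r.
  move=> -[a b] _ /=.
  have [Da Ea] := JP (y + (k - m) *: a).
  have [Db Eb] := JP (y + (k - m) *: b).
  have [Dab Lab] := linear_operatorB _ _ _ _ accL.1 Da Db.
  have := accretive_norm_lower_bound _ _ k _ accL Dab.
  rewrite Lab scalerBr addrACA -opprD Ea Eb opprD addrACA subrr add0r -scalerBr.
  rewrite normrZ => h.
  by rewrite mulrAC ler_pdivlMr // mulrC.
have [p _ /= pf] := banach_fixed_point ctrf closedT (ex_intro _ 0 I).
have [Dp Ep] := JP (y + (k - m) *: p).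
have {pf} pE : J (y + (k - m) *: p) = p by [].
rewrite pE in Dp Ep; exists p => //.
apply: (addIr ((k - m) *: p)).
by rewrite -Ep addrAC -scalerDl (addrC m) subrK.
Qed.

(** A constant in [(0, 1]] is within reach of [1]; a constant [m > 1] is within
    reach of [m - 1 / 2], because [1 / 2 < m - 1 / 2].  Induction on the number
    of half steps above [1] therefore covers every positive constant. *)
Lemma m_accretive_surj D L (k : R) : m_accretive V D L -> 0 < k ->
  set_surj D [set: V] (fun u => k *: u + L u).
Proof.
move=> [accL surj1] k0.
have surj1' : set_surj D [set: V] (fun u => 1 *: u + L u).
  by under eq_fun do rewrite scale1r.
have le1 m : 0 < m -> m <= 1 -> set_surj D [set: V] (fun u => m *: u + L u).
  move=> m0 m1; apply: accretive_surj_near surj1' => //.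
  by rewrite ger0_norm; lra.
suff surjn n m : 0 < m -> m <= 1 + n%:R / 2 ->
    set_surj D [set: V] (fun u => m *: u + L u).
  apply: (surjn (Num.truncn (2 * k)).+1) => //.
  by have := truncnS_gt (2 * k); lra.
elim: n m => [|n IH] m m0 mn; first by apply: le1 => //; lra.
have [/le1|m1] := leP m 1; first exact.
apply: (@accretive_surj_near _ _ (m - 1 / 2)) => //.
  by rewrite ler0_norm; lra.
by apply: IH; move: mn; rewrite -(natr1 n); lra.
Qed.

End accretive_theory.

(** Preserving inner products transports accretivity, and the range condition
    moves along because every vector of [W] is the image of a vector of [V]. *)
Lemma m_accretive_isometry {R : realType} {V W : hilbertType R} (D : set V)
    (L : V -> V) (E : set W) (M : W -> W) (phi : V -> W) :
  linear phi -> (forall x y, inner (phi x) (phi y) = inner x y) ->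
  phi @` [set: V] = [set: W] -> phi @` D = E ->
  (forall x, D x -> M (phi x) = phi (L x)) ->
  m_accretive V D L -> m_accretive W E M.
Proof.
move=> phi_lin phi_iso phiT <- M_phi [[[D0 DL LL] L_ge0] surjL].
have phiD x y : phi (x + y) = phi x + phi y.
  by rewrite -[x in LHS]scale1r phi_lin scale1r.
have phi0 : phi 0 = 0 by apply: (addIr (phi 0)); rewrite -phiD !add0r.
split; first split; first split.
- by exists 0.
- move=> a _ _ [u Du <-] [v Dv <-].
  by exists (a *: u + v); [exact: DL|exact: phi_lin].
- move=> a _ _ [u Du <-] [v Dv <-].
  have Duv := DL a _ _ Du Dv.
  by rewrite -phi_lin !M_phi // LL // phi_lin.
- by move=> _ [u Du <-]; rewrite M_phi // phi_iso L_ge0.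
- move=> w _; have [y _ <-] : (phi @` [set: V]) w by rewrite phiT.
  have [u Du uy] := surjL y I.
  by exists (phi u); [exists u|rewrite M_phi // -phiD uy].
Qed.

Section scale_first_component.
Context {R : realType} {H : hilbertType R}.
Implicit Types (k : R) (D : set H) (L : H -> H).

Definition scale_fst k (x : H * H) : H * H := (k *: x.1, x.2).

Lemma scale_fst_linear k : linear (scale_fst k).
Proof.
move=> a x y; congr pair => /=.
by rewrite scalerDr !scalerA mulrC.
Qed.

Lemma scale_fst_domain D L k : k != 0 -> linear_operator H D L ->
  scale_fst k @` (D `*` [set: H]) = D `*` [set: H].
Proof.
move=> k0 L_lin; apply/seteqP; split=> [_ [[u v] [/= Du _] <-]|[u v] [/= Du _]].
  by split=> //=; exact: (linear_operatorZ _ _ _ _ L_lin Du).1.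
exists (k^-1 *: u, v).
  by split=> //=; exact: (linear_operatorZ _ _ _ _ L_lin Du).1.
by rewrite /scale_fst /= scalerA divff // scale1r.
Qed.

Lemma scale_fst_surj k : k != 0 -> scale_fst k @` [set: H * H] = [set: H * H].
Proof.
move=> k0; rewrite -setXTT.
apply: (@scale_fst_domain setT (fun=> 0)) => //.
by split=> // *; rewrite scaler0 addr0.
Qed.

End scale_first_component.

Section block_operator.
Context {R : realType} {H : hilbertType R}.
Variables (alpha c : R) (alpha0 : 0 < alpha) (c0 : 0 < c).
Variables (D : set H) (L : H -> H).

Lemma weighted_inner_opB (x : weighted H c0) :
  inner (opB alpha c L x : weighted H c0) x =
  c * inner (L x.1) x.1 + alpha * `|c *: x.1 - x.2| ^+ 2.
Proof.
rewrite weighted_innerE inner_norm /=.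
by rewrite !(dotDl, dotDr, dotNl, dotNr, dotZl, dotZr) (dotC _ x.2 x.1); ring.
Qed.

Lemma linear_operator_opB : linear_operator H D L ->
  linear_operator (weighted H c0) (D `*` [set: H]) (opB alpha c L).
Proof.
move=> [D0 DL LL]; split => //.
  by move=> a [u1 u2] [v1 v2] [/= Du _] [/= Dv _]; split => //=; exact: DL.
move=> a [u1 u2] [v1 v2] [/= Du _] [/= Dv _].
congr pair => /=; apply: inner_ext => z; rewrite ?LL //.
  by rewrite !(dotDl, dotNl, dotZl); ring.
by rewrite !(dotDl, dotNl, dotZl); ring.
Qed.

Lemma surj_opB : m_accretive H D L ->
  set_surj (D `*` [set: H]) [set: weighted H c0]
    (fun x : weighted H c0 => x + opB alpha c L x).
Proof.
move=> mL [f g] _.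
have a1 : 0 < 1 + alpha by rewrite addr_gt0.
have k0 : 0 < 1 + alpha * c / (1 + alpha).
  by rewrite addr_gt0 // divr_gt0 // mulr_gt0.
have [u Du uE] :=
  m_accretive_surj _ _ _ mL k0 (f + (alpha / (1 + alpha)) *: g) I.
(* With [u] known, the second row determines the second component. *)
exists (u, (1 + alpha)^-1 *: (g + (alpha * c) *: u)) => //.
congr pair => /=; apply: inner_ext => z.
  have := congr1 (fun w => inner w z) uE.
  rewrite !(dotDl, dotNl, dotZl) => e.
  apply: (addIr (alpha / (1 + alpha) * inner g z)); rewrite -e.
  by field; exact: lt0r_neq0.
by rewrite !(dotDl, dotNl, dotZl); field; exact: lt0r_neq0.
Qed.

End block_operator.

Theorem proposition1 (R : realType) (H : hilbertType R) (alpha c : R)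
    (alpha0 : 0 < alpha) (c0 : 0 < c) (D : set H) (L : H -> H)
    (L_m_accretive : m_accretive H D L) :
  m_accretive (weighted H c0) (D `*` [set: H]) (opB alpha c L) /\
  (m_accretive (weighted H c0) (D `*` [set: H]) (opB alpha c L) <->
   m_accretive (hprod H) (D `*` [set: H]) (opB_tilde alpha c L)).
Proof.
have L_lin := L_m_accretive.1.1.
have sc0 : Num.sqrt c != 0 by rewrite gt_eqF // sqrtr_gt0.
have sqr_sc : Num.sqrt c ^+ 2 = c by rewrite sqr_sqrtr // ltW.
split; first split; first split.
- exact: linear_operator_opB L_lin.
- move=> [u v] [/= Du _]; rewrite weighted_inner_opB /=.
  rewrite addr_ge0 // mulr_ge0 ?(ltW c0) ?(ltW alpha0) ?exprn_ge0 //.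
  exact: L_m_accretive.1.2.
- exact: surj_opB.
split.
- apply: (@m_accretive_isometry _ (weighted H c0) (hprod H) _ _ _ _
    (scale_fst (Num.sqrt c))).
  + exact: scale_fst_linear.
  + move=> x y; rewrite [LHS]hprod_innerE [RHS]weighted_innerE /= dotZl dotZr.
    by rewrite mulrA -expr2 sqr_sc.
  + exact: scale_fst_surj.
  + exact: scale_fst_domain L_lin.
  + move=> [u v] [/= Du _]; rewrite /scale_fst /=.
    have [_ LZ] := linear_operatorZ _ _ (Num.sqrt c) _ L_lin Du.
    congr pair => /=; apply: inner_ext => z.
      by rewrite LZ !(dotDl, dotNl, dotZl); ring.
    by rewrite !(dotDl, dotNl, dotZl) -{3}sqr_sc; ring.
- apply: (@m_accretive_isometry _ (hprod H) (weighted H c0) _ _ _ _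
    (scale_fst (Num.sqrt c)^-1)).
  + exact: scale_fst_linear.
  + move=> x y; rewrite [LHS]weighted_innerE [RHS]hprod_innerE /= dotZl dotZr.
    by rewrite -{1}sqr_sc; field.
  + by apply: scale_fst_surj; rewrite invr_eq0.
  + by apply: scale_fst_domain L_lin; rewrite invr_eq0.
  + move=> [u v] [/= Du _]; rewrite /scale_fst /=.
    have [_ LZ] := linear_operatorZ _ _ (Num.sqrt c)^-1 _ L_lin Du.
    congr pair => /=; apply: inner_ext => z.
      by rewrite LZ !(dotDl, dotNl, dotZl); field.
    by rewrite !(dotDl, dotNl, dotZl) -{1}sqr_sc; field.
Qed.
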